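(* Let $X$ be a compact metric space, $T:X\to X$ continuous, and $\mu$ a $T$-invariant ergodic Borel probability measure on $X$. Let $\alpha=\{A_1,\dots,A_m\}$ be a finite measurable partition of $X$ and let $Z$ be a coarsely optimal compression algorithm. Then for $\mu$-almost every $x\in X$, \[ K_Z(x,\alpha)=h_\mu(T,\alpha), \] where $h_\mu(T,\alpha)$ is the metric (Kolmogorov–Sinai) entropy of $T$ with respect to the partition $\alpha$.
   Context: All logarithms and entropies are in base 2. For a finite measurable partition $\alpha=\{A_1,\dots,A_m\}$ of $X$, the symbolic orbit of $x\in X$ is $\Phi_\alpha(x)=\omega\in\{1,\dots,m\}^{\mathbb{N}}$ defined by $T^j(x)\in A_{\omega_j}$ for all $j$. For $\omega$ an infinite string, $\omega^n$ denotes its first $n$ symbols. A compression algorithm is a total recursive injective (lossless) map $Z$ from finite strings over the alphabet $\{1,\dots,m\}$ to finite binary strings; $K_Z(\omega)=\limsup_{n\to\infty}|Z(\omega^n)|/n$ and $K_Z(x,\alpha)=K_Z(\Phi_\alpha(x))$. Empirical entropy: for a string $s$ of length $n$ and word $w$ of length $l\le n$, $P(s,w)=\frac{1}{n-l+1}\#\{0\le i\le n-l: (s_{i+1},\dots,s_{i+l})=w\}$, $\hat H_l(s)=-\frac1l\sum_{w}P(s,w)\log P(s,w)$ (sum over all words of length $l$, $0\log0=0$). $Z$ is coarsely optimal if for every $k\ge1$ there is $f_k$ with $f_k(n)=o(n)$ such that $|Z(s)|\le|s|\hat H_k(s)+f_k(|s|)$ for every finite string $s$. *)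

(* Defs.v *)
From HB Require Import structures.
From mathcomp Require Import all_boot all_order all_algebra.
From mathcomp Require Import all_classical all_reals all_analysis.
Set Implicit Arguments. Unset Strict Implicit. Unset Printing Implicit Defensive.
Import Order.TTheory GRing.Theory Num.Theory.
Import numFieldNormedType.Exports.
Local Open Scope classical_set_scope.
Local Open Scope ring_scope.

Notation borel X := (g_sigma_algebraType (@open X)).

Section Defs.
Variable R : realType.

Definition log2 (x : R) : R := ln x / ln 2.

Definition plogp (p : R) : R := if p == 0 then 0 else p * log2 p.

Variable X : pseudoPMetricType R.
Local Notation BX := (borel X).

Definition measurable_partition (m : nat) (alpha : 'I_m -> set BX) : Prop :=
  [/\ (forall i, measurable (alpha i)),
      (forall i j, i != j -> alpha i `&` alpha j = set0) &
      \bigcup_(i in [set: 'I_m]) alpha i = [set: BX]].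

Definition meas_preserving (T : BX -> BX) (mu : probability BX R) : Prop :=
  forall A, measurable A -> mu (T @^-1` A) = mu A.

Definition is_ergodic (T : BX -> BX) (mu : probability BX R) : Prop :=
  forall A, measurable A -> T @^-1` A = A -> mu A = 0%E \/ mu A = 1%E.

Definition orbit_prefix (m : nat) (alpha : 'I_m -> set BX) (T : BX -> BX)
  (x : BX) (n : nat) : seq 'I_m :=
  pmap (fun j => [pick i | iter j T x \in alpha i]) (iota 0 n).

Definition cylinder (m n : nat) (alpha : 'I_m -> set BX) (T : BX -> BX)
  (w : n.-tuple 'I_m) : set BX :=
  [set x | forall j : 'I_n, alpha (tnth w j) (iter j T x)].

(** H_mu(alpha v T^-1 alpha v ... v T^-(n-1) alpha) *)
Definition join_entropy (m : nat) (alpha : 'I_m -> set BX) (T : BX -> BX)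
  (mu : probability BX R) (n : nat) : R :=
  - \sum_(w : n.-tuple 'I_m) plogp (fine (mu (cylinder alpha T w))).

Definition ks_entropy (m : nat) (alpha : 'I_m -> set BX) (T : BX -> BX)
  (mu : probability BX R) : R :=
  limn (fun n => join_entropy alpha T mu n / n%:R).

End Defs.

Section Compression.
Variable R : realType.
Variable m : nat.

Definition emp_freq (s w : seq 'I_m) : R :=
  (count (fun i => take (size w) (drop i s) == w)
     (iota 0 (size s - size w).+1))%:R / (size s - size w).+1%:R.

Definition emp_entropy (l : nat) (s : seq 'I_m) : R :=
  - (l%:R)^-1 * \sum_(w : l.-tuple 'I_m) plogp (emp_freq s w).

Definition lossless (Z : seq 'I_m -> seq bool) : Prop := injective Z.

Definition coarsely_optimal (Z : seq 'I_m -> seq bool) : Prop :=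
  forall k : nat, (0 < k)%N -> exists f : nat -> R,
    (fun n => f n / n%:R) @ \oo --> 0 /\
    forall s : seq 'I_m,
      (size (Z s))%:R <= (size s)%:R * emp_entropy k s + f (size s).

(** K_Z(omega) for the string given by its prefixes *)
Definition KZ (Z : seq 'I_m -> seq bool) (prefix : nat -> seq 'I_m) : \bar R :=
  limn_esup (fun n => ((size (Z (prefix n)))%:R / n%:R)%:E).

End Compression.

(* Main.v *)
(** Upper bound: by the ergodic theorem the empirical entropies of order [k]
    along an orbit converge a.e. to [H_k / k], so coarse optimality gives
    [KZ <= h := inf_k H_k / k] a.e.  The ergodic theorem is only needed for
    indicators, where it follows from Garsia's maximal inequality.

    Lower bound: only an upper limit is at stake, so the Shannon-McMillan-Breiman
    theorem is not needed.  Suppose that the set [B] of points whose prefixes of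
    every length [n >= N] are coded with at most [c n] bits has positive measure.
    By ergodicity almost every point enters [B] within [M] steps, up to measure
    [eta]; a word of length [n] of such a point is determined by its first
    symbols before the entrance and by a code word of length at most [c n].
    These words number at most [C 2^(c n)], whence
    [H_n / n <= c + eta log m + o(1)].  So [c >= h] whenever [B] is not
    negligible, which proves [KZ >= h] a.e.  Applied to [c] slightly above [h],
    the same estimate shows that [H_n / n] converges to [h]; subadditivity of
    the entropy is never used. *)
Require Import Defs.
From HB Require Import structures.
From mathcomp Require Import all_boot all_order all_algebra.
From mathcomp Require Import all_classical all_reals all_analysis.
From mathcomp Require Import measurable_realfun zify ring lra.
Import Order.TTheory GRing.Theory Num.Theory.
Import numFieldNormedType.Exports.
Local Open Scope classical_set_scope.
Local Open Scope ring_scope.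

(** * Pointwise ergodic theorem for indicator functions *)

Section Birkhoff.
Context {R : realType} {d : measure_display} {Y : measurableType d}.
Variables (mu : probability Y R) (T : Y -> Y).
Hypothesis mT : measurable_fun setT T.
Hypothesis muT : forall A, measurable A -> mu (T @^-1` A) = mu A.

Definition visits (A : set Y) (n : nat) (x : Y) : R :=
  \sum_(i < n) \1_A (iter i T x).

Lemma visitsS A n x : visits A n.+1 x = \1_A x + visits A n (T x).
Proof.
rewrite /visits big_ord_recl; congr (_ + _).
by apply: eq_bigr => i _; rewrite /= -iterS iterSr.
Qed.

Lemma measurable_iter n : measurable_fun setT (iter n T).
Proof.
elim: n => [|n ih]; first exact: measurable_id.
exact: (measurableT_comp mT ih).
Qed.

Lemma measurable_visits A n : measurable A -> measurable_fun setT (visits A n).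
Proof.
move=> mA; apply: measurable_sum => i.
exact: measurableT_comp (measurable_indic mA) (measurable_iter i).
Qed.

Lemma indic01 A (x : Y) : 0 <= (\1_A x : R) <= 1.
Proof. by rewrite indicE; case: (_ \in _); rewrite /= ?ler01 ?lexx. Qed.

(* [maxsum A c n x] is the maximum over [k <= n] of [visits A k x - c k]. *)
Fixpoint maxsum (A : set Y) (c : R) (n : nat) (x : Y) : R :=
  if n is n'.+1 then Num.max 0 (\1_A x - c + maxsum A c n' (T x)) else 0.

Lemma maxsum_ge0 A c n x : 0 <= maxsum A c n x.
Proof. by case: n => //= n; rewrite le_max lexx. Qed.

Lemma maxsum_nd A c n x : maxsum A c n x <= maxsum A c n.+1 x.
Proof.
elim: n x => [|n ih] x; first exact: maxsum_ge0.
rewrite /= ge_max le_max lexx /= le_max; apply/orP; right.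
by rewrite lerD2l; exact: ih.
Qed.

Lemma visits_le_maxsum A c n x : visits A n x - c * n%:R <= maxsum A c n x.
Proof.
elim: n x => [|n ih] x; first by rewrite /visits big_ord0 mulr0 subr0.
rewrite visitsS /= le_max; apply/orP; right.
have := ih (T x); rewrite -natr1; lra.
Qed.

Lemma measurable_maxsum A c n :
  measurable A -> measurable_fun setT (maxsum A c n).
Proof.
move=> mA; elim: n => [|n ih]; first exact: measurable_cst.
apply: measurable_maxr; first exact: measurable_cst.
apply: measurable_funD; last exact: measurableT_comp ih mT.
by apply: measurable_funB; [exact: measurable_indic|exact: measurable_cst].
Qed.

Lemma ge0_integral_invariant (f : Y -> \bar R) : measurable_fun setT f ->
  (forall x, 0 <= f x)%E -> (\int[mu]_x f (T x) = \int[mu]_x f x)%E.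
Proof.
move=> mf f0.
have := @ge0_integral_pushforward _ _ _ _ _ T mT mu setT f measurableT mf (fun y _ => f0 y).
rewrite preimage_setT => <-.
by apply: eq_measure_integral => // A mA _; exact: muT.
Qed.

Lemma maxsum_le A c n x : 0 <= c -> maxsum A c n x <= n%:R.
Proof.
move=> c0; elim: n x => [//|n ih] x /=.
rewrite ge_max ler0n /= -natr1.
have := ih (T x); have := indic01 A x; lra.
Qed.

(** Garsia's argument. Where [maxsum A c n x] is positive, monotonicity in [n] bounds it by
    [\1_A x - c + maxsum A c n (T x)]; elsewhere it is zero. Integrating cancels the two [maxsum]
    terms by invariance. *)
Lemma maximal_ergodic A c n : measurable A -> 0 <= c ->
  (c%:E * mu [set x | 0 < maxsum A c n x]%R <= mu A)%E.
Proof.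
move=> mA c0; set P := [set x | _].
have mM := measurable_maxsum A c n mA.
have mP : measurable P.
  have := mM measurableT _ (measurable_itv `]0, +oo[).
  rewrite setTI; congr (measurable _); apply/seteqP.
  by split => x /=; rewrite in_itv /= andbT.
have M0 x : (0 <= (maxsum A c n x)%:E)%E by rewrite lee_fin maxsum_ge0.
(* Finiteness is what permits cancelling this integral from both sides of [key]. *)
have fin : (\int[mu]_x (maxsum A c n x)%:E \is a fin_num)%E.
  rewrite ge0_fin_numE; last exact: integral_ge0.
  apply: (@le_lt_trans _ _ (\int[mu]_x (n%:R)%:E)%E).
    apply: ge0_le_integral => //.
    - exact/measurable_EFinP.
    - by move=> x _; rewrite lee_fin maxsum_le.
  by rewrite integral_cst // [X in (_ * X)%E]probability_setT mule1 ltry.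
have key : (\int[mu]_x (maxsum A c n x)%:E + \int[mu]_x (c * \1_P x)%:E
    <= \int[mu]_x (\1_A x)%:E + \int[mu]_x (maxsum A c n (T x))%:E)%E.
  have mMT : measurable_fun setT (fun x => (maxsum A c n (T x))%:E).
    by apply/measurable_EFinP; exact: measurableT_comp mM mT.
  have mc : measurable_fun setT (fun x => (c * \1_P x)%:E).
    apply/measurable_EFinP; apply: measurable_funM; first exact: measurable_cst.
    exact: measurable_indic.
  have mA' : measurable_fun setT (fun x => (\1_A x : R)%:E).
    by apply/measurable_EFinP; exact: measurable_indic.
  rewrite -ge0_integralD//; first last.
  - by move=> x _; rewrite lee_fin mulr_ge0//; case/andP: (indic01 P x).
  - exact/measurable_EFinP.
  rewrite -ge0_integralD//.
  apply: ge0_le_integral => //.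
  - move=> x _; rewrite -EFinD lee_fin addr_ge0 ?maxsum_ge0//.
    by rewrite mulr_ge0//; case/andP: (indic01 P x).
  - by apply: emeasurable_funD => //; exact/measurable_EFinP.
  - exact: emeasurable_funD.
  move=> x _; rewrite -!EFinD lee_fin.
  rewrite [\1_P x]indicE; case: (boolP (x \in P)) => /= [|/negP].
    rewrite inE /P /= => Px.
    have := maxsum_nd A c n x; rewrite /= le_max leNgt Px /=; lra.
  rewrite inE /P /= => /negP; rewrite -leNgt => Px.
  have := maxsum_ge0 A c n (T x); have := indic01 A x; lra.
move: key; rewrite (ge0_integral_invariant (fun x => (maxsum A c n x)%:E))//; last first.
  exact/measurable_EFinP.
rewrite addeC leeD2rE// integral_indic// setIT.
under eq_integral do rewrite EFinM.
rewrite ge0_integralZl_EFin//; last first.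
  by apply/measurable_EFinP; exact: measurable_indic.
by rewrite integral_indic// setIT.
Qed.

Hypothesis ergT :
  forall A, measurable A -> T @^-1` A = A -> mu A = 0%E \/ mu A = 1%E.

(* The set where the conclusion fails is exactly invariant, so ergodicity
   needs no null-set correction. *)
Lemma ae_visits_le A c : measurable A -> (mu A < c%:E)%E ->
  {ae mu, forall x, exists K, forall n, visits A n x <= c * n%:R + K}.
Proof.
move=> mA muAc.
have c0 : 0 < c by rewrite -lte_fin; exact: le_lt_trans muAc.
pose E := \bigcap_k \bigcup_n [set x | k%:R < visits A n x - c * n%:R].
have mE : measurable E.
  apply: bigcapT_measurable => k; apply: bigcupT_measurable => n.
  have m : measurable_fun setT (fun x => visits A n x - c * n%:R).
    by apply: measurable_funB; [exact: measurable_visits|exact: measurable_cst].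
  have := m measurableT _ (measurable_itv `]k%:R, +oo[).
  rewrite setTI; congr (measurable _); apply/seteqP.
  by split => x /=; rewrite in_itv /= andbT.
have ex_nat (r : R) : exists k : nat, r <= k%:R.
  by exists (Num.bound `|r|); exact: ltW (le_lt_trans (ler_norm r) (archi_boundP (normr_ge0 r))).
(* Going from [x] to [T x] while shortening the sum by one term changes [visits A n x - c * n%:R] by
   [\1_A x - c], a bounded amount, so unboundedness persists both ways. *)
have invE : T @^-1` E = E.
  apply/seteqP; split => x Ex k _.
    have [k' hk'] := ex_nat (k%:R + c).
    have [n _ /= hn] := Ex k' I.
    exists n.+1 => //=; rewrite visitsS -natr1.
    have := indic01 A x; lra.
  have [k' hk'] := ex_nat (k%:R + 1).
  have [[|n] _ /= hn] := Ex k' I.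
    by move: hn; rewrite /visits big_ord0 mulr0 subr0 ltNge ler0n.
  exists n => //=; move: hn; rewrite visitsS -natr1.
  have := indic01 A x; lra.
suff E0 : mu E = 0%E.
  exists E; split => // x /= nx k _; apply: contrapT => nn; apply: nx.
  exists k%:R => n; rewrite leNgt; apply/negP => h; apply: nn.
  exists n => //=; lra.
case: (ergT _ mE invE) => // E1.
(* If [E] had full measure, so would the increasing union of the [P n], and the maximal inequality
   would give [c <= mu A] in the limit. *)
pose P n := [set x | 0 < maxsum A c n x].
have mP n : measurable (P n).
  have := measurable_maxsum A c n mA measurableT _ (measurable_itv `]0, +oo[).
  rewrite setTI; congr (measurable _); apply/seteqP.
  by split => x /=; rewrite in_itv /= andbT.
have mUP : measurable (\bigcup_n P n) by exact: bigcupT_measurable.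
have P1 : mu (\bigcup_n P n) = 1%E.
  apply/eqP; rewrite eq_le probability_le1//= -E1.
  apply: le_measure; rewrite ?inE// => x /(_ 0%N I)[n _ /= hn].
  exists n => //; rewrite /P /=.
  exact: lt_le_trans (visits_le_maxsum A c n x).
have cvP : (mu (P n) @[n --> \oo] --> 1%E)%E.
  rewrite -P1; apply: nondecreasing_cvg_mu => //.
  apply/nondecreasing_seqP => n; apply/subsetPset => x; rewrite /P /=.
  by move=> /lt_le_trans; apply; exact: maxsum_nd.
have : (c%:E * 1 <= mu A)%E.
  have cv : (c%:E * mu (P n) @[n --> \oo] --> c%:E * 1)%E by exact: cvgeZl.
  rewrite -(cvg_lim _ cv)//; apply: lime_le; first by apply/cvg_ex; eexists; exact: cv.
  by apply: nearW => n; exact: (maximal_ergodic _ _ _ mA (ltW c0)).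
by rewrite mule1 leNgt muAc.
Qed.

Lemma visitsC A n x : visits (~` A) n x = n%:R - visits A n x.
Proof.
rewrite /visits; elim: n => [|n ih]; first by rewrite !big_ord0 subrr.
rewrite !big_ord_recr /= ih -natr1 !indicE in_setC.
by case: (_ \in _) => /=; lra.
Qed.

Theorem birkhoff_visits A : measurable A ->
  {ae mu, forall x, visits A n x / n%:R @[n --> \oo] --> fine (mu A)}.
Proof.
move=> mA; have mA' := measurableC mA.
pose p := fine (mu A); pose e k : R := k.+1%:R^-1.
have e0 k : 0 < e k by rewrite /e invr_gt0 ltr0n.
have muAE : mu A = p%:E by rewrite fineK// fin_num_measure.
have up k : {ae mu, forall x, exists K, forall n, visits A n x <= (p + e k) * n%:R + K}.
  by apply: ae_visits_le => //; rewrite muAE lte_fin ltrDl.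
have dn k : {ae mu, forall x, exists K, forall n,
    visits (~` A) n x <= (1 - p + e k) * n%:R + K}.
  apply: ae_visits_le => //.
  by rewrite probability_setC// muAE -EFinB lte_fin ltrDl.
move: up dn => /ae_foralln up /ae_foralln dn; apply: filterS2 up dn => x upx dnx.
apply/cvgrPdist_le => eps eps0.
have [k hk] : exists k, e k < eps / 2.
  have := near_infty_natSinv_lt (PosNum (divr_gt0 eps0 (ltr0n R 2))).
  by case=> N _ /(_ N (leqnn N)) h; exists N.
have [K1 hK1] := upx k; have [K2 hK2] := dnx k.
pose K := Num.max 0 (Num.max K1 K2).
near=> n.
have n0 : 0 < n%:R :> R by rewrite ltr0n; near: n; exact: nbhs_infty_gt.
have Kn : K <= eps / 2 * n%:R.
  rewrite mulrC -ler_pdivrMr ?divr_gt0//; near: n; exact: nbhs_infty_ger.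
have KK1 : K1 <= K by rewrite /K !le_max lexx orbT.
have KK2 : K2 <= K by rewrite /K !le_max lexx !orbT.
have ekn : e k * n%:R <= eps / 2 * n%:R by rewrite ler_pM2r// ltW.
have := hK1 n; have := hK2 n; rewrite visitsC => h2 h1.
rewrite ler_norml; apply/andP; split.
  rewrite lerNl opprB lerBlDr ler_pdivrMr//; rewrite -/p; nra.
rewrite lerBlDl -lerBlDr ler_pdivlMr//; rewrite -/p; nra.
Unshelve. all: by end_near. Qed.

(** An orbit that misses [B] has visit frequency zero, whereas almost every frequency tends to
    [mu B > 0]. *)
Lemma probability_bigcup_preimage B : measurable B -> (0 < mu B)%E ->
  mu (\bigcup_i (iter i T @^-1` B)) = 1%E.
Proof.
move=> mB B0.
have mU : measurable (\bigcup_i (iter i T @^-1` B)).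
  apply: bigcupT_measurable => i; rewrite -[X in measurable X]setTI.
  exact: measurable_iter.
have : mu (~` \bigcup_i (iter i T @^-1` B)) = 0%E.
  apply/negligibleP; first exact: measurableC.
  apply: negligibleS (birkhoff_visits _ mB) => x /= nx h; apply: nx.
  have /cvgr_gt := h => /(_ 0); rewrite fine_gt0; last first.
    by rewrite B0 /= -ge0_fin_numE// fin_num_measure.
  move=> /(_ isT)[N _ /(_ N (leqnn N))] /= hN.
  apply: contrapT => no; move: hN.
  rewrite /visits big1 ?mul0r ?ltxx// => i _; rewrite indicE.
  rewrite memNset// => Bi; apply: no; by exists i.
rewrite probability_setC// => /eqP.
by rewrite sube_eq ?add0e ?fin_num_measure// => /eqP.
Qed.

End Birkhoff.

(** * Entropy of finite distributions *)

Section Entropy.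
Context {R : realType}.

Lemma ln2_gt0 : 0 < ln 2 :> R.
Proof. by rewrite ln_gt0// ltr1n. Qed.

Lemma plogpE (p : R) : plogp p = p * log2 p.
Proof. by rewrite /plogp; case: eqP => // ->; rewrite mul0r. Qed.

Lemma plogp_le0 (p : R) : p <= 1 -> 0 <= p -> plogp p <= 0.
Proof.
move=> p1 p0; rewrite plogpE mulr_ge0_le0// /log2 pmulr_lle0 ?ln_le0//.
by rewrite invr_gt0 ln2_gt0.
Qed.

Lemma log2M (x y : R) : 0 < x -> 0 < y -> log2 (x * y) = log2 x + log2 y.
Proof. by move=> x0 y0; rewrite /log2 lnM ?posrE// mulrDl. Qed.

Lemma log2V (x : R) : 0 < x -> log2 x^-1 = - log2 x.
Proof. by move=> x0; rewrite /log2 lnV ?posrE// mulNr. Qed.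

Lemma log2_2 : log2 2 = 1 :> R.
Proof. by rewrite /log2 divff// gt_eqF// ln2_gt0. Qed.

Lemma log2X (x : R) n : 0 < x -> log2 (x ^+ n) = n%:R * log2 x.
Proof. by move=> x0; rewrite /log2 lnXn// mulrA mulr_natl. Qed.

Lemma log2_ge0 (x : R) : 1 <= x -> 0 <= log2 x.
Proof. by move=> x1; rewrite divr_ge0 ?ln_ge0// ler1n. Qed.

(** Continuity of [ln] settles a positive limit; the limit 0 is squeezed between a multiple of the
    square root and 0. *)
Lemma cvg_plogp (u : nat -> R) (p : R) : (forall n, 0 <= u n <= 1) ->
  u n @[n --> \oo] --> p -> plogp (u n) @[n --> \oo] --> plogp p.
Proof.
move=> u01 up.
have p0 : 0 <= p.
  rewrite -(cvg_lim _ up)//; apply: limr_ge; first by apply/cvg_ex; exists p.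
  by apply: nearW => n; case/andP: (u01 n).
under eq_fun do rewrite plogpE; rewrite plogpE.
move: p0 up; rewrite le_eqVlt => /orP[/eqP <-|p0] up; last first.
  apply: cvgM => //; rewrite /log2; apply: cvgMl.
  exact: (continuous_cvg _ (continuous_ln p0) up).
rewrite mul0r.
(* [- ln s <= 1 / s] at [s = sqrt x] bounds [- x ln x] by [2 sqrt x] *)
have bnd (x : R) : 0 <= x <= 1 -> - (2 / ln 2 * Num.sqrt x) <= x * log2 x <= 0.
  case/andP => x0 x1.
  have := plogp_le0 x x1 x0; rewrite plogpE => ->; rewrite andbT.
  move: x0; rewrite le_eqVlt => /orP[/eqP <-|x0].
    by rewrite sqrtr0 mulr0 mul0r oppr0.
  pose s := Num.sqrt x; have s0 : 0 < s by rewrite sqrtr_gt0.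
  have xE : x = s * s by rewrite -expr2 sqr_sqrtr// ltW.
  have sl : - ln s < s^-1 by rewrite -lnV ?posrE// ln_sublinear// invr_gt0.
  have : - 1 <= s * ln s.
    by rewrite -lerN2 opprK -mulrN -ler_pdivlMl// mulr1 ltW.
  move=> h; rewrite -/s xE log2M// /log2.
  have -> : s * s * (ln s / ln 2 + ln s / ln 2) = s * ln s * (2 / ln 2 * s).
    by field; rewrite gt_eqF// ln2_gt0.
  by rewrite -mulN1r ler_pM2r// mulr_gt0// divr_gt0// ln2_gt0.
have sq : - (2 / ln 2 * Num.sqrt (u n)) @[n --> \oo] --> - (2 / ln 2 * Num.sqrt 0).
  apply: cvgN; apply: cvgMr; exact: (continuous_cvg _ (@sqrt_continuous _ _) up).
rewrite sqrtr0 mulr0 oppr0 in sq.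
apply: squeeze_cvgr sq (cvg_cst _); by apply: nearW => n; exact: bnd.
Qed.

(** Sum of [ln t <= t - 1] at [t = q i / p i]. A term with [p i = 0] only requires [q i >= 0]. *)
Lemma gibbs (I : finType) (p q : I -> R) : (forall i, 0 <= p i) ->
  \sum_i p i = 1 -> (forall i, 0 < q i) -> \sum_i q i <= 1 ->
  - \sum_i plogp (p i) <= \sum_i p i * - log2 (q i).
Proof.
move=> p0 p1 q0 q1; rewrite -sumrN -subr_ge0 -sumrB.
apply: (@le_trans _ _ ((\sum_i p i - \sum_i q i) / ln 2)).
  by rewrite divr_ge0 ?subr_ge0 ?p1// ltW// ln2_gt0.
rewrite -sumrB mulr_suml; apply: ler_sum => i _; rewrite plogpE.
move: (p0 i); rewrite le_eqVlt => /orP[/eqP <-|pi0].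
  rewrite !mul0r oppr0 subr0 sub0r pmulr_lle0 ?invr_gt0 ?ln2_gt0// oppr_le0.
  exact: ltW.
have := @le_ln1Dx R (q i / p i - 1).
rewrite ltrBrDl subrr divr_gt0// => /(_ isT).
rewrite addrC subrK ln_div ?posrE// => h.
rewrite /log2 opprK mulrN !mulrA -mulNr -mulrDl ler_pM2r ?invr_gt0 ?ln2_gt0//.
have : p i * (ln (q i) - ln (p i)) <= p i * (q i / p i - 1) by rewrite ler_pM2l.
have -> : p i * (q i / p i - 1) = q i - p i.
  by rewrite mulrBr mulr1 mulrCA divff ?mulr1// gt_eqF.
lra.
Qed.

(* Gibbs' inequality against the mixture of the uniform weights on [S] and
   on the whole alphabet. *)
Lemma entropy_le_card (I : finType) (p : I -> R) (S : {set I}) (N M eta : R) :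
  (forall i, 0 <= p i) -> \sum_i p i = 1 ->
  1 <= N -> #|S|%:R <= N -> 1 <= M -> #|I|%:R <= M ->
  1 - eta <= \sum_(i in S) p i ->
  - \sum_i plogp (p i) <= 1 + log2 N + eta * log2 M.
Proof.
move=> p0 p1 N1 SN M1 IM Seta.
have N0 : 0 < N by exact: lt_le_trans N1.
have M0 : 0 < M by exact: lt_le_trans M1.
(* Each of the two parts has total weight at most 1/2. The cost [- log2 (q i)] is [1 + log2 N] on
   [S] and [1 + log2 M] off it, where the mass is at most [eta]. *)
pose q i := if i \in S then (2 * N)^-1 else (2 * M)^-1.
have splitS (F : I -> R) : \sum_i F i = \sum_(i in S) F i + \sum_(i in ~: S) F i.
  rewrite (bigID (mem S)) /=; congr (_ + _); apply: eq_bigl => i.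
    by rewrite inE.
apply: (le_trans (gibbs I p q p0 p1 _ _)).
- by move=> i; rewrite /q; case: ifP => _; rewrite invr_gt0 mulr_gt0.
- rewrite splitS (eq_bigr (fun=> (2 * N)^-1)); last by move=> i iS; rewrite /q iS.
  rewrite [X in _ + X](eq_bigr (fun=> (2 * M)^-1)); last first.
    by move=> i; rewrite inE /q => /negbTE ->.
  rewrite !sumr_const -![_^-1 *+ _]mulr_natl.
  have h1 : #|S|%:R / (2 * N) <= 1 / 2.
    by rewrite ler_pdivrMr ?mulr_gt0//; lra.
  have h2 : #|~: S|%:R / (2 * M) <= 1 / 2.
    rewrite ler_pdivrMr ?mulr_gt0//.
    have : #|~: S|%:R <= M by apply: le_trans IM; rewrite ler_nat max_card.
    lra.
  lra.
have pE : \sum_(i in S) p i + \sum_(i in ~: S) p i = 1 by rewrite -splitS.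
rewrite splitS (eq_bigr (fun i => p i * (1 + log2 N))); last first.
  by move=> i iS; rewrite /q iS log2V ?mulr_gt0// opprK log2M// log2_2.
rewrite [X in _ + X](eq_bigr (fun i => p i * (1 + log2 M))); last first.
  move=> i; rewrite inE /q => /negbTE ->.
  by rewrite log2V ?mulr_gt0// opprK log2M// log2_2.
rewrite -!mulr_suml.
have pS0 : 0 <= \sum_(i in ~: S) p i by exact: sumr_ge0.
have := log2_ge0 _ N1; have := log2_ge0 _ M1.
move: pE pS0 Seta; set a := \sum_(_ in _) _; set b := \sum_(_ in _) _.
move=> ab b0 aeta lM lN.
have : b * log2 M <= eta * log2 M by rewrite ler_wpM2r//; lra.
have : a * log2 N <= log2 N by rewrite ler_piMl//; lra.
lra.
Qed.

End Entropy.

(** * Counting words with short codes; bounds on upper limits *)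

Lemma card_bseq_bool L : (#|{bseq L of bool}| <= 2 ^ L.+1)%N.
Proof.
rewrite card_bseq card_bool -[\sum_(_ < _) _]mul1n -[1%N]/(2.-1) -predn_exp.
exact: leq_pred.
Qed.

(** A word is the concatenation of its first [i] letters and a suffix that [Z] determines by
    injectivity. The position [i] need not be recorded, so it costs no factor. *)
Lemma card_coded_suffix (m n M L : nat) (Z : seq 'I_m -> seq bool) :
  injective Z ->
  (#|[set w : n.-tuple 'I_m | [exists i : 'I_M, size (Z (drop i w)) <= L]]%SET|
    <= #|{bseq M of 'I_m}| * 2 ^ L.+1)%N.
Proof.
move=> injZ; set S := [set w | _]%SET.
have exi w : w \in S -> exists i : 'I_M, (size (Z (drop i w)) <= L)%N.
  by rewrite inE => /existsP.
(* The last branch is a dummy, never reached on [S]. As [insub_bseq] returns its argument only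
   within the size bound, the sizes are checked before decoding. *)
pose f (w : n.-tuple 'I_m) : {bseq M of 'I_m} * {bseq L of bool} :=
  if [pick i : 'I_M | (size (Z (drop i w)) <= L)%N] is Some i
  then (insub_bseq M (take i w), insub_bseq L (Z (drop i w)))
  else (insub_bseq M [::], insub_bseq L [::]).
apply: (@leq_trans #|{: {bseq M of 'I_m} * {bseq L of bool}}|); last first.
  by rewrite card_prod leq_mul2l card_bseq_bool orbT.
apply: (@leq_card_in _ _ f) => v w /exi[iv hv] /exi[iw hw].
rewrite /f; case: pickP => [i hi|/(_ iv)]; last by rewrite hv.
case: pickP => [j hj|/(_ iw)]; last by rewrite hw.
have szt (k : 'I_M) (s : seq 'I_m) : (size (take k s) <= M)%N.
  by rewrite size_take_min geq_min (ltnW (ltn_ord k)).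
case=> /(congr1 val) /= + /(congr1 val) /=.
rewrite !insubdK -?topredE /= ?szt ?hi ?hj // => tk /injZ dr.
by apply: val_inj; rewrite /= -[LHS](cat_take_drop i) -[RHS](cat_take_drop j) tk dr.
Qed.

Lemma limn_esup_le_near {R : realType} (u : nat -> \bar R) (a : \bar R) :
  (\forall n \near \oo, (u n <= a)%E) -> (limn_esup u <= a)%E.
Proof.
move=> ua; rewrite /limn_esup limf_esupE.
apply: (@le_trans _ _ (ereal_sup [set u n | n in [set n | (u n <= a)%E]])).
  by apply: ereal_inf_lbound; exists [set n | (u n <= a)%E].
by apply: ge_ereal_sup => _ [n /= un <-].
Qed.

Lemma limn_esup_lt {R : realType} (u : nat -> \bar R) (a : \bar R) :
  (limn_esup u < a)%E -> \forall n \near \oo, (u n < a)%E.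
Proof.
rewrite /limn_esup limf_esupE => /ereal_inf_lt[_ [V V_oo <-]] supV.
apply: filterS V_oo => n Vn; apply: le_lt_trans supV.
by apply: ereal_sup_ubound; exists n.
Qed.

(** * Words of a stationary process with finitely many states *)

Section Process.
Context {R : realType} {d : measure_display} {Y : measurableType d}.
Variables (mu : probability Y R) (T : Y -> Y).
Hypothesis mT : measurable_fun setT T.
Hypothesis muT : forall A, measurable A -> mu (T @^-1` A) = mu A.
Hypothesis ergT :
  forall A, measurable A -> T @^-1` A = A -> mu A = 0%E \/ mu A = 1%E.
Variables (m : nat) (cell : Y -> 'I_m).
Hypothesis mcell : forall i, measurable (cell @^-1` [set i]).

Definition word (n : nat) (x : Y) : n.-tuple 'I_m :=
  [tuple cell (iter j T x) | j < n].

Lemma val_word n x :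
  word n x = [seq cell (iter j T x) | j <- iota 0 n] :> seq 'I_m.
Proof. by rewrite /word -val_enum_ord -map_comp /= enumT. Qed.

Lemma drop_word i n x :
  drop i (word n x) = word (n - i) (iter i T x) :> seq 'I_m.
Proof.
rewrite !val_word -map_drop drop_iota add0n -[i in iota i _]addn0 iotaDl.
by rewrite -map_comp; apply: eq_map => j /=; rewrite addnC iterD.
Qed.

Lemma take_word k n x : (k <= n)%N ->
  take k (word n x) = word k x :> seq 'I_m.
Proof. by move=> kn; rewrite !val_word -map_take take_iota (minn_idPl kn). Qed.

(** There are finitely many words, so any event about them is a finite union of cylinders. *)
Lemma measurable_word n (P : n.-tuple 'I_m -> Prop) :
  measurable [set x | P (word n x)].
Proof.
have -> : [set x | P (word n x)] =
    \bigcup_(w in [set w | P w]) \bigcap_(j in [set: 'I_n])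
      (iter j T @^-1` (cell @^-1` [set tnth w j])).
  apply/seteqP; split=> [x /= Px|x [w /= Pw wx]].
    by exists (word n x) => // j _ /=; rewrite tnth_mktuple.
  suff -> : word n x = w by [].
  by apply: eq_from_tnth => j; rewrite tnth_mktuple; exact: wx.
apply: fin_bigcup_measurable; first exact: finite_finset.
move=> w _; apply: fin_bigcap_measurable; first exact: finite_finset.
move=> j _; rewrite -[X in measurable X]setTI.
exact: (measurable_iter _ mT).
Qed.

Definition dist (n : nat) (w : n.-tuple 'I_m) : R :=
  fine (mu [set x | word n x = w]).

Definition block_entropy (n : nat) : R := - \sum_w plogp (dist n w).

Lemma dist_ge0 n w : 0 <= dist n w.
Proof. exact: fine_ge0. Qed.

Lemma sum_dist n (P : pred (n.-tuple 'I_m)) :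
  \sum_(w | P w) dist n w = fine (mu [set x | P (word n x)]).
Proof.
have -> : [set x | P (word n x)] =
    \bigcup_(w in [set w | P w]) [set x | word n x = w].
  by apply/seteqP; split=> [x Px|x [w /= Pw wx]]; [exists (word n x)|rewrite /= wx].
rewrite measure_fin_bigcup; first last.
- by move=> w _; exact: (measurable_word n (fun v => v = w)).
- by move=> v w _ _ [x [/= vx wx]]; rewrite -vx -wx.
- exact: finite_finset.
rewrite (@fsbig_fwiden _ _ _ _ (enum P)).
- rewrite big_enum /= -sum_fine//.
  by move=> w _; rewrite fin_num_measure//; exact: (measurable_word n (fun v => v = w)).
- by move=> w /= Pw; rewrite mem_enum.
- exact: enum_uniq.
- by move=> w [/=]; rewrite mem_enum => Pw /(_ Pw).
Qed.

Lemma sum_distT n : \sum_w dist n w = 1.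
Proof.
rewrite (sum_dist n predT).
have -> : [set x | predT (word n x)] = setT by exact/seteqP.
by rewrite probability_setT.
Qed.

(** An occurrence of [w] at position [i] is a visit of the [i]-th iterate to the cylinder of [w];
    there are [n - k + 1] positions. *)
Lemma emp_freq_word k n x (w : k.-tuple 'I_m) : (k <= n)%N ->
  emp_freq R (word n x) w =
  visits T [set y | word k y = w] (n - k).+1 x / (n - k).+1%:R.
Proof.
move=> kn; rewrite /emp_freq !size_tuple; congr (_ / _).
rewrite -[X in iota 0 X]subn0 -/(index_iota 0 _) -sum1_count.
rewrite big_mkcond /= natr_sum big_mkord; apply: eq_bigr => i _.
have ik : (k <= n - i)%N by have := ltn_ord i; rewrite ltnS; lia.
rewrite drop_word take_word// indicE; congr (nat_of_bool _)%:R.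
by apply/eqP/idP => [/val_inj|]; rewrite inE => // ->.
Qed.

Lemma emp_freq01 (s w : seq 'I_m) : 0 <= emp_freq R s w <= 1.
Proof.
rewrite /emp_freq divr_ge0 ?ler0n// andTb ler_pdivrMr ?ltr0n// mul1r ler_nat.
by rewrite (leq_trans (count_size _ _))// size_iota.
Qed.

Lemma ae_cvg_emp_entropy k :
  {ae mu, forall x, emp_entropy R k (word n x) @[n --> \oo] -->
    block_entropy k / k%:R}.
Proof.
have freq (w : k.-tuple 'I_m) :
  {ae mu, forall x, emp_freq R (word n x) w @[n --> \oo] --> dist k w}.
  have mw := measurable_word k (fun v => v = w).
  have := birkhoff_visits _ _ mT muT ergT _ mw; apply: filterS => x vx.
  (* At length [n + k] the frequency is the visit average over [n + 1] steps. *)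
  rewrite -(cvg_shiftn k) /=.
  under eq_fun do rewrite emp_freq_word ?leq_addl// addnK.
  have := vx; rewrite -cvg_shiftS; exact.
have : {ae mu, forall x, forall w : k.-tuple 'I_m,
    emp_freq R (word n x) w @[n --> \oo] --> dist k w}.
  by apply: filter_forall.
apply: filterS => x fx.
rewrite /emp_entropy /block_entropy mulNr mulrC -mulNr.
apply: cvgMr; apply: (@cvg_big R _ +%R 0 xpredT (@add_continuous R)) => w _.
apply: cvg_plogp => // n; exact: emp_freq01.
Qed.

(** * Code lengths compared with block entropies *)

Section Compressor.
Variable Z : seq 'I_m -> seq bool.

Definition KZ_word (x : Y) : \bar R := KZ R Z (fun n => word n x).

Lemma ae_KZ_le (Zopt : coarsely_optimal R Z) k : (0 < k)%N ->
  {ae mu, forall x, (KZ_word x <= (block_entropy k / k%:R)%:E)%E}.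
Proof.
move=> k0; have [f [f0 Zf]] := Zopt k k0.
have := ae_cvg_emp_entropy k; apply: filterS => x ex.
have cv : emp_entropy R k (word n x) + f n / n%:R @[n --> \oo] -->
    block_entropy k / k%:R by rewrite -[X in _ --> X]addr0; exact: cvgD.
apply/lee_addgt0Pr => e e0; apply: limn_esup_le_near.
have lt_e : block_entropy k / k%:R < block_entropy k / k%:R + e by rewrite ltrDl.
have near_le := cvgr_le _ cv _ lt_e; near=> n.
have n0 : 0 < n%:R :> R by rewrite ltr0n; near: n; exact: nbhs_infty_gt.
rewrite -EFinD lee_fin; apply: (@le_trans _ _ (emp_entropy R k (word n x) + f n / n%:R)).
  rewrite ler_pdivrMr// mulrDl divfK ?gt_eqF// mulrC.
  by have := Zf (word n x); rewrite size_tuple.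
near: n; exact: near_le.
Unshelve. all: by end_near. Qed.

Definition short (c : R) (N : nat) : set Y :=
  [set x | forall n, (N <= n)%N -> (size (Z (word n x)))%:R <= c * n%:R].

Lemma measurable_short c N : measurable (short c N).
Proof.
have -> : short c N = \bigcap_n
    [set x | (N <= n)%N -> (size (Z (word n x)))%:R <= c * n%:R].
  by apply/seteqP; split=> [x Bx n _ /=|x Bx n]; [exact: Bx|exact: (Bx n I)].
apply: bigcapT_measurable => n.
exact: (measurable_word n (fun w => (N <= n)%N -> (size (Z w))%:R <= c * n%:R)).
Qed.

(** An upper limit below [c] puts the point in some [short c N], one of countably many null sets. *)
Lemma ae_KZ_ge c : (forall N, mu (short c N) = 0%E) ->
  {ae mu, forall x, (c%:E <= KZ_word x)%E}.
Proof.
move=> mu0; have : forall N, {ae mu, forall x, ~ short c N x}.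
  move=> N; exists (short c N); split => //; first exact: measurable_short.
  by move=> x /= /contrapT.
move=> /ae_foralln; apply: filterS => x nx.
rewrite leNgt; apply/negP => /limn_esup_lt[N _ ltc].
(* Starting at [N.+1] makes [n] positive, so the division by [n] can be undone. *)
apply: (nx N.+1) => n Nn; have /= := ltc n (ltnW Nn).
by rewrite lte_fin => /ltW; rewrite ler_pdivrMr// ltr0n (leq_ltn_trans _ Nn).
Qed.

(** [entropy_le_card] is applied to the words having a suffix, after fewer than [M] letters, whose
    code has at most [c n] bits. They carry mass at least [1 - eta]. *)
Lemma near_block_entropy_le (Zinj : injective Z) (c e : R) N :
  (0 < mu (short c N))%E -> 0 < e ->
  \forall n \near \oo, block_entropy n / n%:R <= c + e.
Proof.
move=> B0 e0; have mB := measurable_short c N.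
have [x0 Bx0] : exists x, short c N x.
  apply: contrapT => no; move: B0; suff -> : short c N = set0.
    by rewrite measure0 ltxx.
  by apply/seteqP; split => // x Bx; apply: no; exists x.
have c0 : 0 <= c.
  have := le_trans (ler0n R _) (Bx0 N.+1 (leqnSn N)).
  by rewrite pmulr_lge0// ltr0n.
have m1 : 1 <= m%:R :> R.
  by rewrite ler1n; case: (m) (cell x0) => [[]|].
have lm := log2_ge0 _ m1.
(* The summand 1 keeps the denominator positive when [m = 1]. *)
pose eta := e / 2 / (1 + log2 m%:R).
have eta0 : 0 < eta by rewrite !divr_gt0//; lra.
have etam : eta * log2 m%:R <= e / 2.
  by rewrite /eta mulrAC ler_pdivrMr ?ler_pM2l ?divr_gt0//; lra.
pose G M := [set x | exists2 i, (i < M)%N & short c N (iter i T x)].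
have GE M : G M = \bigcup_(i in `I_M) (iter i T @^-1` short c N).
  by apply/seteqP; split=> x [i iM Bi]; exists i.
have mG M : measurable (G M).
  rewrite GE; apply: bigcup_measurable => i _; rewrite -[X in measurable X]setTI.
  exact: (measurable_iter _ mT).
have UG : \bigcup_M G M = \bigcup_i (iter i T @^-1` short c N).
  apply/seteqP; split=> x; first by case=> M _ [i _ Bi]; exists i.
  by case=> i _ Bi; exists i.+1 => //; exists i.
have [M GM] : exists M, 1 - eta <= fine (mu (G M)).
  have : mu (G M) @[M --> \oo] --> (1%:E : \bar R).
    rewrite -(probability_bigcup_preimage _ _ mT muT ergT _ mB B0) -UG.
    apply: nondecreasing_cvg_mu => //; first exact: bigcupT_measurable.
    apply/nondecreasing_seqP => M; apply/subsetPset => x [i iM Bi].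
    by exists i => //; exact: ltnW.
  move=> /fine_cvgP[_] /cvgr_ge /(_ (1 - eta)).
  by rewrite ltrBlDr ltrDl => /(_ eta0)[M _ /(_ M (leqnn M))] ?; exists M.
pose K := #|{bseq M of 'I_m}|.
have K0 : (0 < K)%N by apply/card_gt0P; exists (insub_bseq M [::]).
have K1 : 1 <= K%:R :> R by rewrite ler1n.
near=> n.
have n0 : 0 < n%:R :> R by rewrite ltr0n; near: n; exact: nbhs_infty_gt.
(* Even after fewer than [M] letters are dropped, the suffix has length at least [N]. *)
have nNM : (N + M <= n)%N by near: n; exact: nbhs_infty_ge.
pose L := Num.truncn (c * n%:R).
have Lle : L%:R <= c * n%:R by rewrite truncn_le mulr_ge0// ltW.
pose S := [set w : n.-tuple 'I_m | [exists i : 'I_M, (size (Z (drop i w)) <= L)%N]]%SET.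
have SK : #|S|%:R <= K%:R * 2 ^+ L.+1 :> R.
  by rewrite -natrX -natrM ler_nat card_coded_suffix.
have muS : 1 - eta <= \sum_(w in S) dist n w.
  apply: (le_trans GM); rewrite (sum_dist n (mem S)); apply: fine_le.
  - by rewrite fin_num_measure.
  - by rewrite fin_num_measure//; exact: (measurable_word n (fun w => w \in S)).
  apply: le_measure; rewrite ?inE//.
    exact: (measurable_word n (fun w => w \in S)).
  move=> x [i iM Bi] /=; rewrite inE; apply/existsP; exists (Ordinal iM).
  rewrite /= drop_word truncn_ge_nat ?mulr_ge0//.
  have Nni : (N <= n - i)%N by lia.
  apply: (le_trans (Bi _ Nni)).
  by rewrite ler_wpM2l// ler_nat leq_subr.
have card_words : #|{: n.-tuple 'I_m}|%:R <= m%:R ^+ n :> R.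
  by rewrite card_tuple card_ord natrX.
have := entropy_le_card _ (dist n) S (K%:R * 2 ^+ L.+1) (m%:R ^+ n) eta
  (dist_ge0 n) (sum_distT n) (mulr_ege1 K1 (exprn_ege1 _ _)) SK
  (exprn_ege1 _ m1) card_words muS.
rewrite ler1n => /(_ isT); rewrite -/(block_entropy n).
have m0 := lt_le_trans ltr01 m1; have K0' := lt_le_trans ltr01 K1.
rewrite log2M ?exprn_gt0// !log2X// log2_2 mulr1.
have etan : eta * (n%:R * log2 m%:R) <= e / 2 * n%:R.
  by rewrite mulrCA mulrC ler_pM2r.
(* One unit of the 2 comes from [entropy_le_card], the other from the exponent [L.+1]. *)
have Kn : 2 + log2 K%:R <= e / 2 * n%:R.
  rewrite mulrC -ler_pdivrMr ?divr_gt0//; near: n; exact: nbhs_infty_ger.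
move=> Hn; rewrite ler_pdivrMr//; move: Hn; rewrite -natr1; lra.
Unshelve. all: by end_near. Qed.

Theorem ae_KZ_eq_entropy_rate (Zinj : injective Z) (Zopt : coarsely_optimal R Z) :
  {ae mu, forall x,
    KZ_word x = (limn (fun n => block_entropy n / n%:R))%:E}.
Proof.
(* The shift avoids index 0, where division by zero returns 0 and would make the infimum 0. *)
pose r k := block_entropy k.+1 / k.+1%:R.
pose h := inf (range r).
have H0 k : 0 <= block_entropy k.
  rewrite oppr_ge0; apply: sumr_le0 => w _; apply: plogp_le0 (dist_ge0 k w).
  rewrite -(sum_distT k) (bigD1 w)//= lerDl; apply: sumr_ge0 => v _.
  exact: dist_ge0.
have rinf : has_inf (range r).
  split; first by exists (r 0%N), 0%N.
  by exists 0 => _ [k _ <-]; rewrite divr_ge0.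
have hr k : h <= r k by apply: ge_inf; [exact: rinf.2|exists k].
have le_h : {ae mu, forall x, (KZ_word x <= h%:E)%E}.
  have := fun k => ae_KZ_le Zopt k.+1 (ltn0Sn k).
  move=> /ae_foralln; apply: filterS => x KZr.
  apply/lee_addgt0Pr => e e0; have [_ [k _ <-] rk] := inf_adherent e0 rinf.
  by apply: (le_trans (KZr k)); rewrite -EFinD lee_fin ltW.
have h_le : {ae mu, forall x, (h%:E <= KZ_word x)%E}.
  (* Were some [short (h - j.+1%:R^-1) N] not null, half of the gap would remain as slack and some
     [r n] would fall below [h]. *)
  have : forall j, {ae mu, forall x, ((h - j.+1%:R^-1)%:E <= KZ_word x)%E}.
    move=> j; apply: ae_KZ_ge => N; apply/eqP; rewrite eq_le measure_ge0 andbT.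
    rewrite leNgt; apply/negP => B0.
    have j0 : 0 < j.+1%:R^-1 :> R by rewrite invr_gt0 ltr0n.
    have [n _ /(_ n.+1 (leqnSn n)) /=] :=
      near_block_entropy_le Zinj _ (j.+1%:R^-1 / 2) N B0 (divr_gt0 j0 (ltr0n _ 2)).
    by move=> /(le_trans (hr n)); move: j0; set b := _^-1; lra.
  move=> /ae_foralln; apply: filterS => x hx.
  apply/lee_subgt0Pr => e e0.
  have [j _ /(_ j (leqnn j)) je] := near_infty_natSinv_lt (PosNum e0).
  by apply: le_trans (hx j); rewrite -EFinB lee_fin lerD2l lerN2 ltW.
suff -> : limn (fun n => block_entropy n / n%:R) = h.
  by apply: filterS2 le_h h_le => x xh hx; apply/eqP; rewrite eq_le xh hx.
apply/cvg_lim; first exact: norm_hausdorff.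
apply/cvgrPdist_le => e e0.
(* Otherwise [KZ_word x >= h + e / 2] almost everywhere, which contradicts [le_h] at some point. *)
have [N B0] : exists N, (0 < mu (short (h + e / 2) N))%E.
  apply: contrapT => no.
  have /ae_KZ_ge : forall N, mu (short (h + e / 2) N) = 0%E.
    move=> N; apply/eqP; rewrite eq_le measure_ge0 andbT leNgt.
    by apply/negP => B0; apply: no; exists N.
  have : ProperFilter (almost_everywhere mu).
    by apply: ae_properfilter_algebraOfSetsType; rewrite [X in (_ < X)%E]probability_setT.
  move=> ? ge; have [x [xh]] := filter_ex (filterI le_h ge).
  move=> /le_trans /(_ xh); rewrite lee_fin; lra.
have e2 : 0 < e / 2 by rewrite divr_gt0.
have le_e := near_block_entropy_le Zinj _ _ _ B0 e2.
near=> n.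
have n0 : (0 < n)%N by near: n; exact: nbhs_infty_gt.
have hn : h <= block_entropy n / n%:R by have := hr n.-1; rewrite /r prednK.
have : block_entropy n / n%:R <= h + e / 2 + e / 2 by near: n; exact: le_e.
by rewrite distrC ger0_norm; lra.
Unshelve. all: by end_near. Qed.

End Compressor.
End Process.

(** * Transfer to continuous maps and measurable partitions *)

Lemma continuous_measurable_borel {R : realType} (X : pseudoPMetricType R)
  (T : X -> X) : continuous T ->
  measurable_fun [set: borel X] (T : borel X -> borel X).
Proof.
move=> /continuousP cT; apply: (@measurability _ _ (borel X) (borel X) setT T (@open X) erefl).
by move=> _ [B oB <-]; rewrite setTI; apply: sub_sigma_algebra; exact: cT.
Qed.

Theorem theorem14 (R : realType) (X : pseudoPMetricType R) (hX2 : hausdorff_space X)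
  (hX : compact [set: X])
  (T : X -> X) (hT : continuous T)
  (mu : probability (borel X) R)
  (hinv : meas_preserving T mu) (herg : is_ergodic T mu)
  (m : nat) (alpha : 'I_m -> set (borel X))
  (halpha : measurable_partition alpha)
  (Z : seq 'I_m -> seq bool) (hZ : lossless Z) (hopt : coarsely_optimal R Z) :
  {ae mu, forall x : borel X,
     KZ R Z (orbit_prefix alpha T x) = (ks_entropy alpha T mu)%:E}.
Proof.
have [malpha disj cover] := halpha.
(* The partition becomes a cell-index function, which brings the system under the results on
   processes. *)
have /choice[cell cellP] : forall x : borel X, exists i, alpha i x.
  by move=> x; have : [set: borel X] x by []; rewrite -cover => -[i _]; exists i.
have alphaE x i : alpha i x <-> cell x = i.
  split=> [ix|<-]; last exact: cellP.
  apply/eqP; apply: contrapT => /negP /disj /seteqP[/(_ x) h _].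
  exact: h.
have mcell i : measurable (cell @^-1` [set i]).
  by have -> : cell @^-1` [set i] = alpha i by apply/seteqP; split=> x /alphaE.
(* Since the cells cover the space, [pick] always succeeds and [pmap] discards no letter. *)
have prefixE x : orbit_prefix alpha T x = fun n => @word _ (borel X) T m cell n x.
  apply/funext => n; rewrite val_word /orbit_prefix.
  elim: (iota 0 n) => //= j s ->; case: pickP => [i|/(_ (cell (iter j T x)))].
    by rewrite inE => /alphaE ->.
  by rewrite mem_set//; exact/alphaE.
have entropyE n : join_entropy alpha T mu n = block_entropy mu T m cell n.
  congr (- _); apply: eq_bigr => w _; congr (plogp (fine (mu _))).
  apply/seteqP; split=> x /=.
    by move=> wx; apply: eq_from_tnth => j; rewrite tnth_mktuple; apply/alphaE.
  by move=> <- j; apply/alphaE; rewrite tnth_mktuple.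
have := ae_KZ_eq_entropy_rate mu T (continuous_measurable_borel _ _ hT) hinv herg
  m cell mcell Z hZ hopt.
apply: filterS => x; rewrite /KZ_word prefixE => ->.
by rewrite /ks_entropy; congr (limn _)%:E; apply/funext => n; rewrite entropyE.
Qed.
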